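(* There exists a sequence of entire functions $(f_n)_{n \in \mathbb{N}_0}$ of order one such that $f_0 \not\sim f_n$ and $|f_0| = |f_n|$ on $\mathbb{R} + \tfrac{i}{n} \mathbb{Z}$ for all $n \in \mathbb{N}$.
   Context: $\mathbb{N} = \{1,2,3,\dots\}$ and $\mathbb{N}_0 = \mathbb{N} \cup \{0\}$. For entire functions $f,g$, write $f \sim g$ if there exists $\alpha \in \mathbb{R}$ such that $f = e^{i\alpha} g$. An entire function $f$ is of finite order if $f(z) = O(\exp(|z|^a))$ as $z \to \infty$ for some $a>0$; the infimum of all such $a$ is the order of $f$. For $n \in \mathbb{N}$, $\mathbb{R} + \tfrac{i}{n}\mathbb{Z} = \{x + \tfrac{i m}{n} : x \in \mathbb{R}, m \in \mathbb{Z}\}$. *)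

(* Defs.v *)
From Stdlib Require Import Reals.
From Coquelicot Require Import Coquelicot.

Open Scope R_scope.

(* Differentiability over the normed field C, i.e. complex differentiability. *)
Definition entire (f : C -> C) : Prop :=
  forall z : C, ex_derive (K := C_AbsRing) (V := C_NormedModule) f z.

(* e^{i alpha} *)
Definition cis (alpha : R) : C := (cos alpha, sin alpha).

Definition equiv_phase (f g : C -> C) : Prop :=
  exists alpha : R, forall z : C, f z = (cis alpha * g z)%C.

(* f(z) = O(exp(|z|^a)) as z tends to infinity. [Rpower] is only meaningful at a
   positive base, whence the condition [0 < M]. *)
Definition growth_bound (f : C -> C) (a : R) : Prop :=
  exists K M : R, 0 < M /\
    forall z : C, M <= Cmod z -> Cmod (f z) <= K * exp (Rpower (Cmod z) a).

Definition finite_order (f : C -> C) : Prop :=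
  exists a : R, 0 < a /\ growth_bound f a.

Definition order (f : C -> C) : Rbar :=
  Glb_Rbar (fun a : R => 0 < a /\ growth_bound f a).

Definition entire_of_order (f : C -> C) (rho : R) : Prop :=
  entire f /\ finite_order f /\ order f = Finite rho.

(* The set R + (i/n) Z, for n >= 1. *)
Definition parallel_lines (n : nat) (z : C) : Prop :=
  exists (x : R) (m : Z), z = (RtoC x + Ci * RtoC (IZR m / INR n))%C.

(* Main.v *)
Require Import Defs.
From Stdlib Require Import Reals Lra Lia.
From Coquelicot Require Import Coquelicot.

(** The example is a lacunary product.  With w = exp (2 pi z), put

      f_e (z) = prod_(m >= 1) (1 + i e_m c_m w^m),   c_m = exp (- exp (m^2)),

    for a sequence of signs e_m = 1 or -1; f_0 has all signs 1, and f_n differs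
    from f_0 by the sign of its n-th factor only.

    On R + (i/n) Z the function w^n = exp (2 pi n z) takes positive real values t,
    so changing the sign of the n-th factor replaces 1 + i c t by its conjugate and
    leaves the modulus unchanged ([Cmod_waveprod_flip]).  The two functions are
    nevertheless not proportional: their quotient on the real line is
    (1 + i c t) / (1 - i c t), which is not constant ([waveprod_flip_not_equiv]).

    Since f_0 has to carry a factor of period i/n for every n, its zeros lie on
    circles |w| = const in ever larger numbers, and the decay of c_m has to push
    these circles far out.  A factor 1 + exp (m rho - b) with b = exp (m^2) is close
    to 1 while m rho <= b/2, and m rho > b/2 forces m^2 - m <= log (2 rho); only
    the few factors of the second kind contribute to the growth, and altogether
    log |f_e (z)| <= 1 + C_eps |z|^(1 + eps) for every eps > 0
    ([one_plus_coef_le], [waveprod_growth]).  On the real line every factor has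
    modulus at least 1 and the first one grows like exp (2 pi x), so the order is
    not less than one ([growth_bound_ge_1]).

    Holomorphy of the product is shown without Cauchy's integral formula.  At a
    point z, the sum of bounds for |p(z)|, for |p'(z)| and for the second-order Taylor
    remainder on the unit disc around z is a submultiplicative quantity
    ([jet_le_mult]).  Hence partial products of factors 1 + u_k with summable bounds
    satisfy a Taylor estimate with one remainder constant, and the estimate passes
    to the limit ([ex_derive_infinite_product]). *)

(** * Limits of complex sequences *)

(** Convergence is measured by the modulus, so that estimates pass to the limit
    without going through real and imaginary parts. *)
Definition tends (a : nat -> C) (l : C) : Prop :=
  is_lim_seq (fun n => Cmod (a n - l)%C) 0.

(** A limit operator defined for all sequences, hence usable inside the definition of
    a function; the components are taken separately because limits of real sequences
    are available as a total operator. *)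
Definition Clim (a : nat -> C) : C :=
  (real (Lim_seq (fun n => fst (a n))), real (Lim_seq (fun n => snd (a n)))).

Lemma Cmod_le_abs (z : C) : Cmod z <= Rabs (fst z) + Rabs (snd z).
Proof.
  destruct z as [x y]; unfold Cmod; cbn [fst snd].
  apply Rsqr_incr_0_var.
  2: generalize (Rabs_pos x) (Rabs_pos y); lra.
  rewrite Rsqr_sqrt by nra.
  rewrite <- (pow2_abs x), <- (pow2_abs y).
  unfold Rsqr; generalize (Rabs_pos x) (Rabs_pos y); nra.
Qed.

Lemma fst_le_Cmod (z : C) : Rabs (fst z) <= Cmod z.
Proof. eapply Rle_trans; [apply Rmax_l | apply Rmax_Cmod]. Qed.

Lemma snd_le_Cmod (z : C) : Rabs (snd z) <= Cmod z.
Proof. eapply Rle_trans; [apply Rmax_r | apply Rmax_Cmod]. Qed.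

Lemma Cmod_minus_sym (a b : C) : Cmod (a - b)%C = Cmod (b - a)%C.
Proof. rewrite <- Cmod_opp; f_equal; ring. Qed.

Lemma Cmod_triangle_minus (a b c : C) :
  Cmod (a - c)%C <= Cmod (a - b)%C + Cmod (b - c)%C.
Proof.
  replace (a - c)%C with ((a - b) + (b - c))%C by ring; apply Cmod_triangle.
Qed.

Lemma tends_squeeze (a : nat -> C) (l : C) (b : nat -> R) :
  is_lim_seq b 0 -> (forall n, Cmod (a n - l)%C <= b n) -> tends a l.
Proof.
  intros Hb H; apply is_lim_seq_le_le with (fun _ => 0) b; auto.
  - intros n; split; auto; apply Cmod_ge_0.
  - apply is_lim_seq_const.
Qed.

Lemma tends_minus (a b : nat -> C) (l m : C) :
  tends a l -> tends b m -> tends (fun n => a n - b n)%C (l - m)%C.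
Proof.
  intros Ha Hb.
  apply tends_squeeze with (fun n => Cmod (a n - l)%C + Cmod (b n - m)%C).
  - replace (Finite 0) with (Rbar_plus 0 0) by (cbn; f_equal; ring).
    now apply is_lim_seq_plus'.
  - intros n; rewrite (Cmod_minus_sym (b n)).
    replace (a n - b n - (l - m))%C with ((a n - l) + (m - b n))%C by ring.
    apply Cmod_triangle.
Qed.

Lemma tends_scal (c : C) (a : nat -> C) (l : C) :
  tends a l -> tends (fun n => c * a n)%C (c * l)%C.
Proof.
  intros Ha; apply tends_squeeze with (fun n => Cmod c * Cmod (a n - l)%C).
  - replace (Finite 0) with (Rbar_mult (Cmod c) 0)
      by (cbn; f_equal; ring).
    now apply is_lim_seq_scal_l.
  - intros n; replace (c * a n - c * l)%C with (c * (a n - l))%C by ring.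
    rewrite Cmod_mult; lra.
Qed.

Lemma tends_Cmod_le (a : nat -> C) (l : C) (B : R) (N : nat) :
  tends a l -> (forall n, (N <= n)%nat -> Cmod (a n) <= B) -> Cmod l <= B.
Proof.
  intros Ha H.
  cut (Rbar_le (Cmod l - B) 0); [cbn; lra|].
  apply (is_lim_seq_le_loc (fun _ => Cmod l - B) (fun n => Cmod (a n - l)%C));
    [|apply is_lim_seq_const | exact Ha].
  exists N; intros n Hn; specialize (H n Hn).
  pose proof (Cmod_triangle (a n) (l - a n)%C) as T.
  replace (a n + (l - a n))%C with l in T by ring.
  rewrite (Cmod_minus_sym (a n)); lra.
Qed.

Lemma tends_Cmod_ge (a : nat -> C) (l : C) (B : R) (N : nat) :
  tends a l -> (forall n, (N <= n)%nat -> B <= Cmod (a n)) -> B <= Cmod l.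
Proof.
  intros Ha H.
  cut (Rbar_le (B - Cmod l) 0); [cbn; lra|].
  apply (is_lim_seq_le_loc (fun _ => B - Cmod l) (fun n => Cmod (a n - l)%C));
    [|apply is_lim_seq_const | exact Ha].
  exists N; intros n Hn; specialize (H n Hn).
  pose proof (Cmod_triangle l (a n - l)%C) as T.
  replace (l + (a n - l))%C with (a n) in T by ring; lra.
Qed.

Lemma tends_unique (a b : nat -> C) (l m : C) (N : nat) :
  tends a l -> tends b m -> (forall n, (N <= n)%nat -> a n = b n) -> l = m.
Proof.
  intros Ha Hb H.
  assert (Cmod (l - m)%C <= 0) as Hle.
  { apply (tends_Cmod_le _ _ _ N (tends_minus _ _ _ _ Ha Hb)).
    intros n Hn; rewrite (H n Hn).
    replace (b n - b n)%C with (RtoC 0) by ring; rewrite Cmod_0; lra. }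
  assert (l - m = 0)%C as E
    by (apply Cmod_eq_0; generalize (Cmod_ge_0 (l - m)%C); lra).
  replace l with ((l - m) + m)%C by ring; rewrite E; ring.
Qed.

Lemma tends_Cmod_eq (a b : nat -> C) (l m : C) :
  tends a l -> tends b m -> (forall n, Cmod (a n) = Cmod (b n)) ->
  Cmod l = Cmod m.
Proof.
  intros Ha Hb H.
  assert (forall (c : nat -> C) k, tends c k ->
    is_lim_seq (fun n => Cmod (c n)) (Cmod k)) as L.
  { intros c k Hc.
    apply is_lim_seq_le_le with (fun n => Cmod k - Cmod (c n - k)%C)
      (fun n => Cmod k + Cmod (c n - k)%C).
    - intros n; pose proof (Cmod_triangle k (c n - k)%C) as T1.
      pose proof (Cmod_triangle (c n) (k - c n)%C) as T2.
      replace (k + (c n - k))%C with (c n) in T1 by ring.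
      replace (c n + (k - c n))%C with k in T2 by ring.
      rewrite (Cmod_minus_sym k) in T2; lra.
    - replace (Finite (Cmod k)) with (Finite (Cmod k - 0)) by (f_equal; ring).
      apply is_lim_seq_minus'; [apply is_lim_seq_const | exact Hc].
    - replace (Finite (Cmod k)) with (Finite (Cmod k + 0)) by (f_equal; ring).
      apply is_lim_seq_plus'; [apply is_lim_seq_const | exact Hc]. }
  pose proof (is_lim_seq_unique _ _ (L _ _ Ha)) as Ua.
  pose proof (is_lim_seq_unique _ _ (L _ _ Hb)) as Ub.
  rewrite (Lim_seq_ext _ _ H), Ub in Ua.
  now injection Ua.
Qed.

Lemma exp_le_compat (x y : R) : x <= y -> exp x <= exp y.
Proof.
  intros [H | ->]; [left; now apply exp_increasing | right; reflexivity].
Qed.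

Lemma half_pow_pos (n : nat) : 0 < (/2) ^ n.
Proof. apply pow_lt; lra. Qed.

Lemma geometric_increments (a : nat -> C) (A : R) :
  (forall n, Cmod (a (S n) - a n)%C <= A * (/2) ^ S n) ->
  forall n k, Cmod (a (n + k)%nat - a n)%C <= A * ((/2) ^ n - (/2) ^ (n + k)).
Proof.
  intros H n; induction k as [|k IH].
  - rewrite Nat.add_0_r; replace (a n - a n)%C with (RtoC 0) by ring.
    rewrite Cmod_0; lra.
  - rewrite Nat.add_succ_r.
    eapply Rle_trans; [apply (Cmod_triangle_minus _ (a (n + k)%nat))|].
    specialize (H (n + k)%nat); cbn [pow] in *; lra.
Qed.

(** The geometric tail bound makes both component sequences Cauchy. *)
Lemma tends_Clim (a : nat -> C) (A : R) :
  (forall n, Cmod (a (S n) - a n)%C <= A * (/2) ^ S n) -> tends a (Clim a).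
Proof.
  intros H.
  assert (0 <= A) as HA.
  { specialize (H 0%nat); generalize (Cmod_ge_0 (a 1%nat - a 0%nat)%C).
    cbn in H; lra. }
  assert (forall n k, (n <= k)%nat -> Cmod (a k - a n)%C <= A * (/2) ^ n) as B.
  { intros n k Hk; replace k with (n + (k - n))%nat by lia.
    eapply Rle_trans; [apply (geometric_increments a A H)|].
    generalize (half_pow_pos (n + (k - n))); nra. }
  assert (is_lim_seq (fun n => A * (/2) ^ n) 0) as L0.
  { replace (Finite 0) with (Rbar_mult A 0) by (cbn; f_equal; ring).
    apply is_lim_seq_scal_l, is_lim_seq_geom; rewrite Rabs_pos_eq; lra. }
  assert (forall (pr : C -> R), (forall x y, pr (x - y)%C = pr x - pr y) ->
    (forall x, Rabs (pr x) <= Cmod x) ->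
    is_lim_seq (fun n => pr (a n)) (real (Lim_seq (fun n => pr (a n))))) as P.
  { intros pr Hm Hle.
    apply Lim_seq_correct', ex_lim_seq_cauchy_corr.
    intros eps.
    assert (0 < eps / 2) as He by (destruct eps as [e He]; cbn; lra).
    apply is_lim_seq_spec in L0.
    destruct (L0 (mkposreal _ He)) as [N HN]; exists N; intros n m Hn Hm'.
    specialize (HN N (le_n _)); cbn in HN; rewrite Rminus_0_r in HN.
    pose proof (B N n Hn); pose proof (B N m Hm').
    rewrite <- Hm; eapply Rle_lt_trans; [apply Hle|].
    eapply Rle_lt_trans; [apply (Cmod_triangle_minus _ (a N))|].
    rewrite (Cmod_minus_sym (a N)).
    apply Rabs_def2 in HN; lra. }
  assert (forall u : nat -> R, is_lim_seq u (real (Lim_seq u)) ->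
    is_lim_seq (fun n => Rabs (u n - real (Lim_seq u))) 0) as Q.
  { intros u Hu; rewrite <- Rabs_R0; apply (is_lim_seq_abs _ (Finite 0)).
    replace 0 with (real (Lim_seq u) - real (Lim_seq u)) by ring.
    apply is_lim_seq_minus'; [exact Hu | apply is_lim_seq_const]. }
  apply tends_squeeze with
    (fun n => Rabs (fst (a n) - fst (Clim a)) + Rabs (snd (a n) - snd (Clim a))).
  - replace (Finite 0) with (Finite (0 + 0)) by (f_equal; ring).
    apply is_lim_seq_plus'; apply Q; apply P; try reflexivity.
    + apply fst_le_Cmod.
    + apply snd_le_Cmod.
  - intros n; apply (Cmod_le_abs (a n - Clim a)%C).
Qed.

(** * Infinite products of holomorphic functions *)

(** [A] bounds the sum of the three parts of the first-order Taylor expansion of [p]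
    at [z] with slope [d]: value, slope, and remainder divided by |h|^2.  Asking for
    |h| <= 1 is what lets the higher powers of h produced by a product be absorbed
    into the remainder. *)
Definition jet_le (p : C -> C) (z d : C) (A : R) : Prop :=
  exists a0 a1 a2 : R,
    a0 + a1 + a2 <= A /\ Cmod (p z) <= a0 /\ Cmod d <= a1 /\
    forall h, Cmod h <= 1 -> Cmod (p (z + h) - p z - h * d)%C <= a2 * Cmod h ^ 2.

Lemma jet_le_nonneg (a2 : R) (g : C -> C) :
  (forall h, Cmod h <= 1 -> Cmod (g h) <= a2 * Cmod h ^ 2) -> 0 <= a2.
Proof.
  intros H; specialize (H (RtoC 1)); rewrite Cmod_1 in H.
  generalize (Cmod_ge_0 (g (RtoC 1))); lra.
Qed.

Lemma jet_le_weaken (p : C -> C) (z d : C) (A B : R) :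
  jet_le p z d A -> A <= B -> jet_le p z d B.
Proof.
  intros (a0 & a1 & a2 & HA & H) HB; exists a0, a1, a2; split; [lra | exact H].
Qed.

Lemma jet_le_val (p : C -> C) (z d : C) (A : R) :
  jet_le p z d A -> Cmod (p z) <= A /\ Cmod d <= A.
Proof.
  intros (a0 & a1 & a2 & HA & H0 & H1 & H2).
  apply jet_le_nonneg in H2.
  generalize (Cmod_ge_0 (p z)) (Cmod_ge_0 d); lra.
Qed.

Lemma jet_le_rem (p : C -> C) (z d h : C) (A : R) :
  jet_le p z d A -> Cmod h <= 1 ->
  Cmod (p (z + h) - p z - h * d)%C <= A * Cmod h ^ 2.
Proof.
  intros (a0 & a1 & a2 & HA & H0 & H1 & H2) Hh.
  eapply Rle_trans; [apply (H2 h Hh)|].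
  apply Rmult_le_compat_r; [apply pow2_ge_0|].
  generalize (Cmod_ge_0 (p z)) (Cmod_ge_0 d); lra.
Qed.

Lemma jet_le_const (c z : C) : jet_le (fun _ => c) z 0 (Cmod c).
Proof.
  exists (Cmod c), 0, 0; repeat split; rewrite ?Cmod_0; try lra.
  intros h _; replace (c - c - h * 0)%C with (RtoC 0) by ring.
  rewrite Cmod_0; lra.
Qed.

Lemma jet_le_plus (p q : C -> C) (z d e : C) (A B : R) :
  jet_le p z d A -> jet_le q z e B ->
  jet_le (fun x => p x + q x)%C z (d + e)%C (A + B).
Proof.
  intros (a0 & a1 & a2 & HA & A0 & A1 & A2) (b0 & b1 & b2 & HB & B0 & B1 & B2).
  exists (a0 + b0), (a1 + b1), (a2 + b2); repeat split; [lra | | |].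
  - eapply Rle_trans; [apply Cmod_triangle | lra].
  - eapply Rle_trans; [apply Cmod_triangle | lra].
  - intros h Hh; specialize (A2 h Hh); specialize (B2 h Hh).
    replace (p (z + h) + q (z + h) - (p z + q z) - h * (d + e))%C with
      ((p (z + h) - p z - h * d) + (q (z + h) - q z - h * e))%C by ring.
    eapply Rle_trans; [apply Cmod_triangle | lra].
Qed.

(** Expanding (p + h d + r) (q + h e + s), the terms of order at least two in h are,
    after bounding powers of |h| by |h|^2, exactly the six products missing from
    value and slope in (a0 + a1 + a2) (b0 + b1 + b2). *)
Lemma jet_le_mult (p q : C -> C) (z d e : C) (A B : R) :
  jet_le p z d A -> jet_le q z e B ->
  jet_le (fun x => p x * q x)%C z (d * q z + p z * e)%C (A * B).
Proof.
  intros (a0 & a1 & a2 & HA & A0 & A1 & A2) (b0 & b1 & b2 & HB & B0 & B1 & B2).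
  pose proof (jet_le_nonneg _ _ A2) as A2p.
  pose proof (jet_le_nonneg _ _ B2) as B2p.
  pose proof (Cmod_ge_0 (p z)); pose proof (Cmod_ge_0 (q z)).
  pose proof (Cmod_ge_0 d); pose proof (Cmod_ge_0 e).
  assert (forall x y s t : R, 0 <= x -> 0 <= y -> x <= s -> y <= t -> x * y <= s * t)
    as M by (intros; apply Rmult_le_compat; auto).
  exists (a0 * b0), (a1 * b0 + a0 * b1),
    (a2 * b0 + a0 * b2 + a1 * b1 + a1 * b2 + a2 * b1 + a2 * b2).
  repeat split.
  - apply Rle_trans with ((a0 + a1 + a2) * (b0 + b1 + b2)); [nra|].
    apply M; lra.
  - rewrite Cmod_mult; apply M; lra.
  - eapply Rle_trans; [apply Cmod_triangle|]; rewrite !Cmod_mult.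
    apply Rplus_le_compat; apply M; lra.
  - intros h Hh; specialize (A2 h Hh); specialize (B2 h Hh).
    set (r := (p (z + h) - p z - h * d)%C) in *.
    set (s := (q (z + h) - q z - h * e)%C) in *.
    replace (p (z + h) * q (z + h) - p z * q z - h * (d * q z + p z * e))%C with
      (r * q z + p z * s + h ^ 2 * (d * e) + h * (d * s + r * e) + r * s)%C
      by (unfold r, s; ring).
    pose proof (Cmod_ge_0 h) as Hh0.
    set (t := Cmod h) in *.
    pose proof (Cmod_ge_0 r) as Hr; pose proof (Cmod_ge_0 s) as Hs.
    assert (0 <= t ^ 2) as Ht by apply pow2_ge_0.
    assert (t ^ 2 <= 1) as Ht1 by (cbn; nra).
    eapply Rle_trans; [apply Cmod_triangle|].
    eapply Rle_trans; [apply Rplus_le_compat_r, Cmod_triangle|].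
    eapply Rle_trans; [apply Rplus_le_compat_r, Rplus_le_compat_r, Cmod_triangle|].
    eapply Rle_trans;
      [apply Rplus_le_compat_r, Rplus_le_compat_r, Rplus_le_compat_r, Cmod_triangle|].
    rewrite !Cmod_mult, Cmod_pow; fold t.
    assert (Cmod r * Cmod (q z) <= (a2 * t ^ 2) * b0) by (apply M; lra).
    assert (Cmod (p z) * Cmod s <= a0 * (b2 * t ^ 2)) by (apply M; lra).
    assert (Cmod d * Cmod e <= a1 * b1) by (apply M; lra).
    assert (Cmod d * Cmod s <= a1 * (b2 * t ^ 2)) by (apply M; lra).
    assert (Cmod r * Cmod e <= (a2 * t ^ 2) * b1) by (apply M; lra).
    assert (Cmod r * Cmod s <= (a2 * t ^ 2) * (b2 * t ^ 2)) by (apply M; lra).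
    assert (t ^ 2 * (Cmod d * Cmod e) <= t ^ 2 * (a1 * b1))
      by (apply Rmult_le_compat_l; assumption).
    assert (0 <= Cmod (d * s + r * e)%C) by apply Cmod_ge_0.
    pose proof (Cmod_triangle (d * s)%C (r * e)%C) as T; rewrite !Cmod_mult in T.
    assert (t * Cmod (d * s + r * e)%C <= 1 * (Cmod d * Cmod s + Cmod r * Cmod e))
      by (apply M; lra).
    assert ((a2 * t ^ 2) * (b2 * t ^ 2) <= (a2 * t ^ 2) * (b2 * 1)).
    { apply Rmult_le_compat_l; [nra|]. apply Rmult_le_compat_l; lra. }
    lra.
Qed.

Lemma jet_le_pow (p : C -> C) (z d : C) (A : R) (n : nat) :
  jet_le p z d A ->
  jet_le (fun x => p x ^ n)%C z (INR n * d * p z ^ pred n)%C (A ^ n).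
Proof.
  intros H; induction n as [|n IH].
  - replace (INR 0 * d * p z ^ pred 0)%C with (RtoC 0)
      by (change (INR 0) with 0; ring).
    replace (A ^ 0) with (Cmod (RtoC 1)) by apply Cmod_1.
    apply (jet_le_const (RtoC 1)).
  - replace (INR (S n) * d * p z ^ pred (S n))%C
      with (d * p z ^ n + p z * (INR n * d * p z ^ pred n))%C.
    + exact (jet_le_mult _ _ _ _ _ _ _ H IH).
    + rewrite S_INR, RtoC_plus; destruct n as [|n];
        [change (INR 0) with 0|]; cbn [pred Cpow]; ring.
Qed.

Fixpoint prodC (u : nat -> C) (N : nat) : C :=
  match N with
  | O => RtoC 1
  | S n => (prodC u n * (1 + u n))%C
  end.

(** The derivative of [prodC], the du_k being the derivatives of the u_k. *)
Fixpoint dprodC (u du : nat -> C) (N : nat) : C :=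
  match N with
  | O => RtoC 0
  | S n => (dprodC u du n * (1 + u n) + prodC u n * du n)%C
  end.

(** The jet bound of 1 + u_k is at most 1 + A / 2^(k+1) <= exp (A / 2^(k+1)), and the
    exponents add up to A (1 - 1/2^N). *)
Lemma jet_le_prodC (u : nat -> C -> C) (du : nat -> C) (z : C) (A : R) (N : nat) :
  0 <= A ->
  (forall k, jet_le (u k) z (du k) (A * (/2) ^ S k)) ->
  jet_le (fun x => prodC (fun k => u k x) N) z
    (dprodC (fun k => u k z) du N) (exp (A * (1 - (/2) ^ N))).
Proof.
  intros HA H; induction N as [|N IH]; cbn [prodC dprodC].
  - replace (exp (A * (1 - (/2) ^ 0))) with (Cmod (RtoC 1)).
    + apply jet_le_const.
    + rewrite Cmod_1; cbn [pow].
      replace (A * (1 - 1)) with 0 by ring; now rewrite exp_0.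
  - pose proof (jet_le_plus _ _ _ _ _ _ _ (jet_le_const (RtoC 1) z) (H N)) as H1.
    pose proof (jet_le_mult _ _ _ _ _ _ _ IH H1) as H2.
    replace (0 + du N)%C with (du N) in H2 by ring.
    apply (jet_le_weaken _ _ _ _ _ H2).
    rewrite Cmod_1.
    replace (A * (1 - (/2) ^ S N)) with (A * (1 - (/2) ^ N) + A * (/2) ^ S N)
      by (cbn; field).
    rewrite exp_plus; apply Rmult_le_compat_l; [left; apply exp_pos|].
    apply exp_ineq1_le.
Qed.

Lemma ex_derive_of_quadratic (f : C -> C) (z d : C) (M : R) :
  (forall h, Cmod h <= 1 -> Cmod (f (z + h) - f z - h * d)%C <= M * Cmod h ^ 2) ->
  ex_derive (K := C_AbsRing) (V := C_NormedModule) f z.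
Proof.
  intros H; exists d; split.
  - apply is_linear_scal_l.
  - intros x Hx eps.
    rewrite <- (is_filter_lim_locally_unique (V := AbsRing_NormedModule C_AbsRing)
                  _ _ Hx).
    assert (0 <= M) as HM
      by exact (jet_le_nonneg M (fun h => (f (z + h) - f z - h * d)%C) H).
    assert (0 < Rmin 1 (eps / (M + 1))) as Hd.
    { apply Rmin_glb_lt; [lra|].
      apply Rdiv_lt_0_compat; [apply cond_pos | lra]. }
    exists (mkposreal _ Hd); intros y Hy.
    change (Cmod (y - z)%C < Rmin 1 (eps / (M + 1))) in Hy.
    change (Cmod ((f y - f z) - (y - z) * d)%C <= eps * Cmod (y - z)%C).
    assert (Cmod (y - z)%C < 1) as H1
      by (eapply Rlt_le_trans; [exact Hy | apply Rmin_l]).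
    assert (Cmod (y - z)%C < eps / (M + 1)) as H2
      by (eapply Rlt_le_trans; [exact Hy | apply Rmin_r]).
    specialize (H (y - z)%C (Rlt_le _ _ H1)).
    assert (forall a b : C, (a + (b - a))%C = b) as E by (intros; ring).
    rewrite E in H.
    eapply Rle_trans; [exact H|].
    pose proof (Cmod_ge_0 (y - z)%C) as H0.
    set (t := Cmod (y - z)%C) in *.
    assert (t * (M + 1) <= eps) as H3.
    { apply Rle_trans with (eps / (M + 1) * (M + 1)); [nra | right; field; lra]. }
    cbn [pow]; nra.
Qed.

(** Consecutive partial products differ by P_N u_N, whose jet bound is geometrically
    small; so both the P_N and their derivatives converge.  The Taylor estimate for
    P_N has the constant exp A, independent of N, and therefore holds for the limit. *)
Theorem ex_derive_infinite_product
  (u : nat -> C -> C) (du : C -> nat -> C) (A : C -> R) :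
  (forall z, 0 <= A z) ->
  (forall z k, jet_le (u k) z (du z k) (A z * (/2) ^ S k)) ->
  (forall z, tends (prodC (fun k => u k z)) (Clim (prodC (fun k => u k z)))) /\
  entire (fun z => Clim (prodC (fun k => u k z))).
Proof.
  intros HA H.
  assert (forall z N, exp (A z * (1 - (/2) ^ N)) <= exp (A z)) as HE.
  { intros z N; apply exp_le_compat; generalize (HA z) (half_pow_pos N); nra. }
  assert (forall z N, jet_le (fun x => prodC (fun k => u k x) N * u N x)%C z
    (dprodC (fun k => u k z) (du z) N * u N z + prodC (fun k => u k z) N * du z N)%C
    (exp (A z) * A z * (/2) ^ S N)) as HT.
  { intros z N.
    pose proof (jet_le_mult _ _ _ _ _ _ _
      (jet_le_prodC _ _ _ _ N (HA z) (H z)) (H z N)) as J.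
    apply (jet_le_weaken _ _ _ _ _ J).
    rewrite Rmult_assoc; apply Rmult_le_compat_r; [|apply HE].
    generalize (HA z) (half_pow_pos (S N)); nra. }
  assert (forall z, tends (prodC (fun k => u k z)) (Clim (prodC (fun k => u k z))))
    as HP.
  { intros z; apply tends_Clim with (exp (A z) * A z); intros N.
    destruct (jet_le_val _ _ _ _ (HT z N)) as [V _].
    replace (_ - _)%C with (prodC (fun k => u k z) N * u N z)%C
      by (cbn [prodC]; ring).
    exact V. }
  split; [exact HP|]; intros z.
  assert (tends (dprodC (fun k => u k z) (du z))
    (Clim (dprodC (fun k => u k z) (du z)))) as HD.
  { apply tends_Clim with (exp (A z) * A z); intros N.
    destruct (jet_le_val _ _ _ _ (HT z N)) as [_ V].
    replace (_ - _)%C with (dprodC (fun k => u k z) (du z) N * u N z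
      + prodC (fun k => u k z) N * du z N)%C by (cbn [dprodC]; ring).
    exact V. }
  apply ex_derive_of_quadratic with
    (Clim (dprodC (fun k => u k z) (du z))) (exp (A z)).
  intros h Hh.
  refine (tends_Cmod_le _ _ _ 0 (tends_minus _ _ _ _
    (tends_minus _ _ _ _ (HP (z + h)%C) (HP z)) (tends_scal h _ _ HD)) _).
  intros N _.
  eapply Rle_trans.
  - exact (jet_le_rem _ _ _ h _ (jet_le_prodC _ _ _ _ N (HA z) (H z)) Hh).
  - apply Rmult_le_compat_r; [apply pow2_ge_0 | apply HE].
Qed.

(** * The exponential with period the imaginary unit *)

Definition cexp (z : C) : C := (RtoC (exp (fst z)) * cis (snd z))%C.

Lemma cexp_plus (z w : C) : cexp (z + w)%C = (cexp z * cexp w)%C.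
Proof.
  destruct z as [x y], w as [s t]; unfold cexp, cis, Cmult, Cplus, RtoC; cbn [fst snd].
  rewrite exp_plus, cos_plus, sin_plus; f_equal; ring.
Qed.

Lemma Cmod_cexp (z : C) : Cmod (cexp z) = exp (fst z).
Proof.
  unfold cexp; rewrite Cmod_mult, Cmod_R, Rabs_pos_eq by (left; apply exp_pos).
  unfold cis, Cmod; cbn [fst snd].
  replace (cos (snd z) ^ 2 + sin (snd z) ^ 2) with 1
    by (rewrite <- (sin2_cos2 (snd z)); unfold Rsqr; ring).
  rewrite sqrt_1; ring.
Qed.

Lemma exp_minus_1_abs (x : R) : Rabs (exp x - 1) <= Rabs x * exp (Rabs x).
Proof.
  pose proof (exp_ineq1_le x) as H1.
  pose proof (exp_ineq1_le (- x)) as H2.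
  pose proof (exp_pos x) as H3.
  assert (exp x * exp (- x) = 1) as H4
    by (rewrite <- exp_plus, Rplus_opp_r; apply exp_0).
  assert (exp x - 1 <= x * exp x) as H5 by nra.
  pose proof (exp_ineq1_le (Rabs x)) as H6.
  destruct (Rle_dec 0 x) as [Hx | Hx].
  - rewrite (Rabs_pos_eq x Hx), Rabs_pos_eq by lra; exact H5.
  - rewrite (Rabs_left x) in * by lra.
    rewrite Rabs_left1 by nra; nra.
Qed.

(** From exp (- x) >= 1 - x one gets exp x - 1 <= x exp x, hence
    0 <= exp x - 1 - x <= x (exp x - 1). *)
Lemma exp_taylor_abs (x : R) : Rabs (exp x - 1 - x) <= Rabs x ^ 2 * exp (Rabs x).
Proof.
  pose proof (exp_ineq1_le x) as H1.
  pose proof (exp_ineq1_le (- x)) as H2.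
  pose proof (exp_pos x) as H3.
  assert (exp x * exp (- x) = 1) as H4
    by (rewrite <- exp_plus, Rplus_opp_r; apply exp_0).
  rewrite Rabs_pos_eq by lra.
  apply Rle_trans with (x * (exp x - 1)); [nra|].
  eapply Rle_trans; [apply Rle_abs|]; rewrite Rabs_mult.
  pose proof (exp_minus_1_abs x); pose proof (Rabs_pos x); nra.
Qed.

Lemma sin_abs_le (y : R) : Rabs (sin y) <= Rabs y.
Proof.
  destruct (MVT_gen sin 0 y cos) as (c & _ & Hc).
  - intros; apply is_derive_sin.
  - intros; apply continuity_sin.
  - rewrite sin_0, !Rminus_0_r in Hc; rewrite Hc, Rabs_mult.
    assert (Rabs (cos c) <= 1) by (apply Rabs_le; pose proof (COS_bound c); lra).
    pose proof (Rabs_pos y); nra.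
Qed.

Lemma one_minus_cos_le (y : R) : 0 <= 1 - cos y <= Rabs y ^ 2.
Proof.
  split; [pose proof (COS_bound y); lra|].
  replace y with (2 * (y / 2)) at 1 by field.
  rewrite cos_2a_sin.
  pose proof (sin_abs_le (y / 2)) as H.
  assert (Rabs (y / 2) = Rabs y / 2) as E
    by (unfold Rdiv; rewrite Rabs_mult, (Rabs_pos_eq (/2)); lra).
  rewrite E in H.
  assert (sin (y / 2) * sin (y / 2) <= (Rabs y / 2) * (Rabs y / 2)).
  { apply Rsqr_le_abs_1; rewrite (Rabs_pos_eq (Rabs y / 2)); [exact H|].
    pose proof (Rabs_pos y); lra. }
  pose proof (Rabs_pos y); nra.
Qed.

Lemma sin_minus_id_abs (y : R) : Rabs (sin y - y) <= 2 * Rabs y ^ 2.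
Proof.
  destruct (MVT_gen (fun t => sin t - t) 0 y (fun t => cos t - 1)) as (c & Hc & H).
  - intros; auto_derive; auto; ring.
  - intros; reg.
  - rewrite sin_0, !Rminus_0_r in H; rewrite H, Rabs_mult.
    rewrite <- Rabs_Ropp, Ropp_minus_distr.
    pose proof (one_minus_cos_le c) as [H1 H2].
    pose proof (COS_bound c) as [H3 H4].
    assert (Rabs c <= Rabs y) as Hcy.
    { unfold Rmin, Rmax in Hc; destruct (Rle_dec 0 y);
        unfold Rabs; destruct (Rcase_abs c), (Rcase_abs y); lra. }
    rewrite (Rabs_pos_eq (1 - cos c)) by exact H1.
    pose proof (Rabs_pos c).
    assert (1 - cos c <= 2 * Rabs y); [|pose proof (Rabs_pos y); nra].
    destruct (Rle_dec (Rabs c) 1); nra.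
Qed.

(** The real part of exp k - 1 - k is (e^x - 1 - x) + e^x (cos y - 1), the imaginary
    part (e^x - 1) sin y + (sin y - y); each of the four summands is quadratic.  The
    estimate is needed for |k| up to 2 pi, so it is stated for all k. *)
Lemma cexp_remainder (k : C) :
  Cmod (cexp k - 1 - k)%C <= 5 * exp (Cmod k) * Cmod k ^ 2.
Proof.
  pose proof (fst_le_Cmod k) as Hx; pose proof (snd_le_Cmod k) as Hy.
  eapply Rle_trans; [apply Cmod_le_abs|].
  destruct k as [x y]; unfold cexp, cis, Cmult, Cminus, Cplus, Copp, RtoC.
  cbn [fst snd] in *; set (t := Cmod (x, y)) in *.
  set (m := exp t).
  assert (exp (Rabs x) <= m) as Hm by now apply exp_le_compat.
  pose proof (Rabs_pos x); pose proof (Rabs_pos y).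
  assert (0 <= t) by lra.
  assert (1 <= m) as Hm1 by (pose proof (exp_ineq1_le t); unfold m; lra).
  pose proof (exp_pos (Rabs x)).
  assert (Rabs x ^ 2 <= t ^ 2) by (apply pow_incr; lra).
  assert (Rabs y ^ 2 <= t ^ 2) by (apply pow_incr; lra).
  assert (0 <= t ^ 2) by apply pow2_ge_0.
  assert (Rabs (exp x - 1 - x) <= m * t ^ 2) as T1.
  { eapply Rle_trans; [apply exp_taylor_abs|]; rewrite Rmult_comm.
    apply Rmult_le_compat; try lra; apply pow2_ge_0. }
  assert (Rabs (exp x * (cos y - 1)) <= m * t ^ 2) as T2.
  { rewrite Rabs_mult; apply Rmult_le_compat; try apply Rabs_pos.
    - rewrite Rabs_pos_eq by (left; apply exp_pos).
      eapply Rle_trans; [apply exp_le_compat, Rle_abs | exact Hm].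
    - pose proof (one_minus_cos_le y) as [? ?].
      rewrite Rabs_left1; lra. }
  assert (Rabs ((exp x - 1) * sin y) <= m * t ^ 2) as T3.
  { rewrite Rabs_mult.
    replace (m * t ^ 2) with ((t * m) * t) by ring.
    apply Rmult_le_compat; try apply Rabs_pos.
    - eapply Rle_trans; [apply exp_minus_1_abs|].
      apply Rmult_le_compat; lra.
    - eapply Rle_trans; [apply sin_abs_le | exact Hy]. }
  assert (Rabs (sin y - y) <= 2 * (m * t ^ 2)) as T4.
  { eapply Rle_trans; [apply sin_minus_id_abs|]; nra. }
  replace (exp x * cos y - 0 * sin y + - (1) + - x) with
    ((exp x - 1 - x) + exp x * (cos y - 1)) by ring.
  replace (exp x * sin y + 0 * cos y + - 0 + - y) with
    ((exp x - 1) * sin y + (sin y - y)) by ring.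
  pose proof (Rabs_triang (exp x - 1 - x) (exp x * (cos y - 1))).
  pose proof (Rabs_triang ((exp x - 1) * sin y) (sin y - y)).
  lra.
Qed.

(** The variable w = exp (2 pi z), of period i. *)
Definition wave (z : C) : C := cexp (RtoC (2 * PI) * z)%C.

Lemma Cmod_wave (z : C) : Cmod (wave z) = exp (2 * PI * fst z).
Proof.
  unfold wave; rewrite Cmod_cexp; destruct z as [x y]; cbn; f_equal; ring.
Qed.

Lemma exp_INR_mult (n : nat) (x : R) : exp (INR n * x) = exp x ^ n.
Proof.
  induction n as [|n IH].
  - cbn; rewrite Rmult_0_l; apply exp_0.
  - rewrite S_INR; cbn [pow]; rewrite <- IH, <- exp_plus; f_equal; ring.
Qed.

Lemma cexp_pow (z : C) (n : nat) : (cexp z ^ n)%C = cexp (RtoC (INR n) * z)%C.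
Proof.
  induction n as [|n IH].
  - change (INR 0) with 0; rewrite Cmult_0_l; cbn [Cpow].
    unfold cexp, cis; cbn [fst snd RtoC].
    rewrite exp_0, cos_0, sin_0; symmetry; apply Cmult_1_l.
  - rewrite S_INR, RtoC_plus, Cpow_S, IH, <- cexp_plus; f_equal; ring.
Qed.

Lemma cis_2PI_IZR (m : Z) : cis (2 * (IZR m * PI)) = RtoC 1.
Proof.
  assert (sin (IZR m * PI) = 0) as H by (apply sin_eq_0_1; now exists m).
  unfold cis; rewrite cos_2a_sin, sin_2a, H; unfold RtoC; f_equal; ring.
Qed.

(** For z = x + i m / n the exponent 2 pi n z is 2 pi n x + 2 pi i m. *)
Lemma wave_line (n : nat) (z : C) :
  (1 <= n)%nat -> parallel_lines n z ->
  (wave z ^ n)%C = RtoC (exp (2 * PI * fst z) ^ n).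
Proof.
  intros Hn (x & m & ->).
  assert (INR n <> 0) as Hn0 by (apply not_0_INR; lia).
  assert ((RtoC x + Ci * RtoC (IZR m / INR n))%C = (x, (IZR m / INR n)%R)) as E
    by (unfold Ci, RtoC, Cmult, Cplus; cbn [fst snd]; f_equal; ring).
  rewrite E; cbn [fst].
  unfold wave; rewrite cexp_pow.
  assert ((RtoC (INR n) * (RtoC (2 * PI) * (x, (IZR m / INR n)%R)))%C
    = ((INR n * (2 * PI * x))%R, (2 * (IZR m * PI))%R)) as E2
    by (unfold RtoC, Cmult; cbn [fst snd]; f_equal; field; exact Hn0).
  rewrite E2; unfold cexp; cbn [fst snd]; rewrite cis_2PI_IZR, Cmult_1_r.
  now rewrite exp_INR_mult.
Qed.

(** Value, slope and remainder of [wave], relative to its modulus: the remainder is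
    that of the exponential at k = 2 pi h with |h| <= 1. *)
Definition wave_const : R := 1 + 2 * PI + 5 * exp (2 * PI) * (2 * PI) ^ 2.

Lemma jet_le_wave (z : C) :
  jet_le wave z (RtoC (2 * PI) * wave z)%C (exp (2 * PI * fst z) * wave_const).
Proof.
  pose proof PI_RGT_0 as HPI.
  set (m := exp (2 * PI * fst z)).
  exists m, (2 * PI * m), (m * (5 * exp (2 * PI) * (2 * PI) ^ 2)).
  rewrite Cmod_mult, Cmod_wave, Cmod_R, Rabs_pos_eq by lra; fold m.
  repeat split; try lra; [unfold wave_const; lra|].
  intros h Hh; unfold wave.
  rewrite Cmult_plus_distr_l, cexp_plus; fold (wave z).
  set (k := (RtoC (2 * PI) * h)%C).
  replace (wave z * cexp k - wave z - h * (RtoC (2 * PI) * wave z))%C with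
    (wave z * (cexp k - 1 - k))%C by (unfold k; ring).
  rewrite Cmod_mult, Cmod_wave; fold m.
  rewrite Rmult_assoc; apply Rmult_le_compat_l; [left; apply exp_pos|].
  eapply Rle_trans; [apply cexp_remainder|].
  assert (Cmod k = 2 * PI * Cmod h) as E
    by (unfold k; rewrite Cmod_mult, Cmod_R, Rabs_pos_eq; lra).
  rewrite E, Rpow_mult_distr, <- Rmult_assoc.
  pose proof (pow2_ge_0 (Cmod h)); pose proof (pow2_ge_0 (2 * PI)).
  apply Rmult_le_compat_r; [assumption|].
  apply Rmult_le_compat_r; [assumption|].
  apply Rmult_le_compat_l; [lra|].
  apply exp_le_compat; pose proof (Cmod_ge_0 h); nra.
Qed.

(** * Growth of the coefficients *)

(** Factors are numbered from 0, the k-th one carrying the power k + 1 of w. *)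
Definition coef (k : nat) : R := exp (- exp (INR (S k) ^ 2)).

Lemma coef_pos (k : nat) : 0 < coef k.
Proof. apply exp_pos. Qed.

Lemma exp_opp_INR_le (n : nat) : exp (- INR n) <= (/2) ^ n.
Proof.
  replace (- INR n) with (INR n * - (1)) by ring; rewrite exp_INR_mult.
  apply pow_incr; split; [left; apply exp_pos|].
  rewrite exp_Ropp; apply Rinv_le_contravar; [lra|].
  pose proof (exp_ineq1_le 1); lra.
Qed.

Lemma coef_mult_exp (rho : R) (k : nat) :
  coef k * exp rho ^ S k = exp (INR (S k) * rho - exp (INR (S k) ^ 2)).
Proof. unfold coef; rewrite <- exp_INR_mult, <- exp_plus; f_equal; ring. Qed.

(** exp (n^2) >= n^2, and n rho - n^2 <= (rho + 1)^2 - n by completing the square. *)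
Lemma coef_decay (rho : R) (k : nat) :
  coef k * exp rho ^ S k <= exp ((rho + 1) ^ 2) * (/2) ^ S k.
Proof.
  rewrite coef_mult_exp.
  eapply Rle_trans; [|apply Rmult_le_compat_l;
    [left; apply exp_pos | apply exp_opp_INR_le]].
  rewrite <- exp_plus; apply exp_le_compat.
  set (n := INR (S k)).
  pose proof (exp_ineq1_le (n ^ 2)).
  assert (0 <= (rho + 1) ^ 2 - n * (rho + 1) + n ^ 2); [|lra].
  replace ((rho + 1) ^ 2 - n * (rho + 1) + n ^ 2) with
    ((rho + 1 - n / 2) ^ 2 + 3 / 4 * n ^ 2) by field.
  pose proof (pow2_ge_0 (rho + 1 - n / 2)); pose proof (pow2_ge_0 n); lra.
Qed.

(** The exponent is minus the minimum over n of eps n^2 - (2 + eps) n. *)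
Definition growth_const (eps : R) : R := exp ((2 + eps) ^ 2 / (4 * eps)).

(** With n = k + 1 and b = exp (n^2), the second summand on the left is
    exp (n rho - b).  If n rho <= b / 2 it is at most exp (- b / 2) <= exp (- n).
    Otherwise put L = log (2 rho): then n^2 < n + L, the left side is at most
    exp (2 n rho) with 2 n rho <= exp (n + L), and eps (n^2 - n) <= eps L pays for the
    factor exp (2 n) needed to make the exponent summable over n. *)
Lemma one_plus_coef_le (eps rho : R) (k : nat) :
  0 < eps -> 0 < rho ->
  1 + coef k * exp rho ^ S k <=
  exp ((1 + growth_const eps * Rpower (2 * rho) (1 + eps)) * (/2) ^ S k).
Proof.
  intros He Hrho; rewrite coef_mult_exp.
  assert (0 < growth_const eps) as HG by apply exp_pos.
  assert (0 < Rpower (2 * rho) (1 + eps)) as HR by apply exp_pos.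
  pose proof (half_pow_pos (S k)) as Hh.
  pose proof (exp_opp_INR_le (S k)) as Hhalf.
  assert (1 <= INR (S k)) as Hn.
  { rewrite S_INR; pose proof (pos_INR k); lra. }
  set (n := INR (S k)) in *; set (b := exp (n ^ 2)).
  assert (1 + n ^ 2 <= b) as Hb by apply exp_ineq1_le.
  destruct (Rle_dec (n * rho) (b / 2)) as [Hs | Hs].
  - eapply Rle_trans; [apply exp_ineq1_le|]; apply exp_le_compat.
    assert (exp (n * rho - b) <= exp (- n)) by (apply exp_le_compat; nra).
    assert (0 < growth_const eps * Rpower (2 * rho) (1 + eps))
      by now apply Rmult_lt_0_compat.
    nra.
  - apply Rnot_le_lt in Hs.
    assert (1 <= n * rho) as Hs1 by nra.
    set (L := ln (2 * rho)).
    assert (exp L = 2 * rho) as HL by (apply exp_ln; lra).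
    assert (n <= exp n) as Hnexp by (pose proof (exp_ineq1_le n); lra).
    assert (n ^ 2 <= n + L) as HnL.
    { left; apply exp_lt_inv; rewrite exp_plus, HL; fold b.
      apply Rlt_le_trans with (n * (2 * rho)); [lra|].
      apply Rmult_le_compat_r; lra. }
    apply Rle_trans with (exp (2 * (n * rho))).
    { assert (exp (n * rho - b) <= exp (n * rho)) by (apply exp_le_compat; nra).
      replace (2 * (n * rho)) with (n * rho + n * rho) by ring.
      rewrite exp_plus; pose proof (exp_ineq1_le (n * rho)); nra. }
    apply exp_le_compat.
    apply Rle_trans with (growth_const eps * Rpower (2 * rho) (1 + eps) * exp (- n)).
    2: { assert (0 < growth_const eps * Rpower (2 * rho) (1 + eps))
           by now apply Rmult_lt_0_compat.
         nra. }
    unfold growth_const, Rpower; fold L; rewrite <- !exp_plus.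
    apply Rle_trans with (exp (n + L)).
    { rewrite exp_plus, HL; nra. }
    apply exp_le_compat.
    assert (0 <= (2 + eps) ^ 2 / (4 * eps) + eps * (n ^ 2 - n) - 2 * n); [|nra].
    (* completing the square; [growth_const] was chosen for this *)
    replace (_ + _ - _) with (eps * (n - (2 + eps) / (2 * eps)) ^ 2) by (field; lra).
    apply Rmult_le_pos; [lra | apply pow2_ge_0].
Qed.

(** * The wave products *)

Definition term (e : nat -> R) (k : nat) (z : C) : C :=
  (RtoC (e k * coef k) * Ci * wave z ^ S k)%C.

Definition waveprod (e : nat -> R) (z : C) : C :=
  Clim (prodC (fun k => term e k z)).

Definition is_sign (e : nat -> R) : Prop := forall k, Rabs (e k) = 1.

Lemma Cmod_term_const (e : nat -> R) (k : nat) :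
  is_sign e -> Cmod (RtoC (e k * coef k) * Ci)%C = coef k.
Proof.
  intros He; rewrite Cmod_mult, Cmod_Ci, Cmod_R, Rabs_mult, He.
  rewrite Rabs_pos_eq by (left; apply coef_pos); ring.
Qed.

Lemma Cmod_term (e : nat -> R) (k : nat) (z : C) :
  is_sign e -> Cmod (term e k z) = coef k * exp (2 * PI * fst z) ^ S k.
Proof.
  intros He; unfold term.
  now rewrite Cmod_mult, Cmod_term_const, Cmod_pow, Cmod_wave.
Qed.

Lemma waveprod_entire (e : nat -> R) :
  is_sign e ->
  (forall z, tends (prodC (fun k => term e k z)) (waveprod e z)) /\
  entire (waveprod e).
Proof.
  intros He.
  apply (ex_derive_infinite_product (term e)
    (fun z k => (0 * wave z ^ S k + (RtoC (e k * coef k) * Ci) *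
       (RtoC (INR (S k)) * (RtoC (2 * PI) * wave z) * wave z ^ k))%C)
    (fun z => exp ((2 * PI * fst z + wave_const + 1) ^ 2))).
  - intros z; left; apply exp_pos.
  - intros z k.
    pose proof (jet_le_mult _ _ _ _ _ _ _
      (jet_le_const (RtoC (e k * coef k) * Ci)%C z)
      (jet_le_pow _ _ _ _ (S k) (jet_le_wave z))) as J.
    apply (jet_le_weaken _ _ _ _ _ J).
    rewrite Cmod_term_const by exact He.
    eapply Rle_trans; [|apply coef_decay].
    apply Rmult_le_compat_l; [left; apply coef_pos|].
    assert (0 <= wave_const).
    { unfold wave_const; pose proof PI_RGT_0; pose proof (exp_pos (2 * PI)).
      pose proof (pow2_ge_0 (2 * PI)); nra. }
    apply pow_incr; split.
    + apply Rmult_le_pos; [left; apply exp_pos | assumption].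
    + rewrite exp_plus; apply Rmult_le_compat_l; [left; apply exp_pos|].
      pose proof (exp_ineq1_le wave_const); lra.
Qed.

Lemma tends_waveprod (e : nat -> R) (z : C) :
  is_sign e -> tends (prodC (fun k => term e k z)) (waveprod e z).
Proof. intros He; now apply waveprod_entire. Qed.

Lemma Cmod_prodC_le (u : nat -> C) (B : R) (N : nat) :
  0 <= B -> (forall k, 1 + Cmod (u k) <= exp (B * (/2) ^ S k)) ->
  Cmod (prodC u N) <= exp B.
Proof.
  intros HB H.
  apply Rle_trans with (exp (B * (1 - (/2) ^ N))).
  - induction N as [|N IH]; cbn [prodC].
    + cbn [pow]; replace (B * (1 - 1)) with 0 by ring; rewrite exp_0, Cmod_1; lra.
    + replace (B * (1 - (/2) ^ S N)) with (B * (1 - (/2) ^ N) + B * (/2) ^ S N)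
        by (cbn; field).
      rewrite Cmod_mult, exp_plus.
      apply Rmult_le_compat; try apply Cmod_ge_0; [exact IH|].
      eapply Rle_trans; [apply Cmod_triangle|]; rewrite Cmod_1; apply H.
  - apply exp_le_compat; pose proof (half_pow_pos N); nra.
Qed.

Lemma Cmod_waveprod_le (e : nat -> R) (eps : R) (z : C) :
  is_sign e -> 0 < eps -> 0 < Cmod z ->
  Cmod (waveprod e z) <=
  exp (1 + growth_const eps * Rpower (4 * PI * Cmod z) (1 + eps)).
Proof.
  intros He Heps Hz; pose proof PI_RGT_0 as HPI.
  apply (tends_Cmod_le _ _ _ 0 (tends_waveprod e z He)); intros N _.
  apply Cmod_prodC_le.
  - assert (0 < growth_const eps * Rpower (4 * PI * Cmod z) (1 + eps))
      by (apply Rmult_lt_0_compat; apply exp_pos); lra.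
  - intros k; rewrite Cmod_term by exact He.
    replace (4 * PI * Cmod z) with (2 * (2 * PI * Cmod z)) by ring.
    eapply Rle_trans; [|apply one_plus_coef_le; nra].
    apply Rplus_le_compat_l, Rmult_le_compat_l; [left; apply coef_pos|].
    apply pow_incr; split; [left; apply exp_pos|]; apply exp_le_compat.
    apply Rmult_le_compat_l; [lra|].
    eapply Rle_trans; [apply Rle_abs | apply fst_le_Cmod].
Qed.

(** With eps = (a - 1) / 2 the constant D in front of |z|^(1 + eps) is absorbed by the
    remaining factor |z|^eps as soon as |z| >= D^(1 / eps). *)
Lemma waveprod_growth (e : nat -> R) (a : R) :
  is_sign e -> 1 < a -> growth_bound (waveprod e) a.
Proof.
  intros He Ha; pose proof PI_RGT_0 as HPI.
  set (eps := (a - 1) / 2); assert (0 < eps) as Heps by (unfold eps; lra).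
  set (D := growth_const eps * Rpower (4 * PI) (1 + eps)).
  assert (0 < D) as HD by (apply Rmult_lt_0_compat; apply exp_pos).
  exists (exp 1), (Rpower D (/ eps)); split; [apply exp_pos|].
  intros z Hz; set (r := Cmod z) in *.
  assert (0 < r) as Hr by (eapply Rlt_le_trans; [apply exp_pos | exact Hz]).
  eapply Rle_trans; [apply (Cmod_waveprod_le e eps z He Heps Hr)|].
  fold r; rewrite exp_plus; apply Rmult_le_compat_l; [left; apply exp_pos|].
  apply exp_le_compat.
  rewrite <- Rpower_mult_distr, <- Rmult_assoc by lra; fold D.
  replace a with (eps + (1 + eps)) by (unfold eps; field).
  rewrite (Rpower_plus eps).
  apply Rmult_le_compat_r; [left; apply exp_pos|].
  replace D with (Rpower (Rpower D (/ eps)) eps).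
  - apply Rle_Rpower_l; [lra|]; split; [apply exp_pos | exact Hz].
  - rewrite Rpower_mult, Rinv_l by lra; now apply Rpower_1.
Qed.

Lemma term_line (e : nat -> R) (k : nat) (z : C) :
  parallel_lines (S k) z ->
  term e k z = (RtoC (e k * (coef k * exp (2 * PI * fst z) ^ S k)) * Ci)%C.
Proof.
  intros Hz; unfold term.
  rewrite (wave_line (S k) z) by (auto; lia).
  rewrite !RtoC_mult; ring.
Qed.

Lemma real_in_parallel_lines (n : nat) (x : R) : parallel_lines n (RtoC x).
Proof.
  exists x, 0%Z; unfold Rdiv; rewrite Rmult_0_l; ring.
Qed.

Lemma Cmod_one_plus_imag (t : R) : Cmod (1 + RtoC t * Ci)%C = sqrt (1 + t ^ 2).
Proof.
  unfold Cmod, RtoC, Ci, Cmult, Cplus; cbn [fst snd]; f_equal; ring.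
Qed.

Lemma Cmod_one_plus_imag_ge (t : R) :
  1 <= Cmod (1 + RtoC t * Ci)%C /\ Rabs t <= Cmod (1 + RtoC t * Ci)%C.
Proof.
  rewrite Cmod_one_plus_imag; pose proof (pow2_ge_0 t); split.
  - rewrite <- sqrt_1 at 1; apply sqrt_le_1; lra.
  - rewrite <- sqrt_Rsqr_abs; unfold Rsqr; apply sqrt_le_1; nra.
Qed.

Lemma Cmod_prodC_ge (u : nat -> C) (N : nat) :
  (forall k, 1 <= Cmod (1 + u k)%C) -> (1 <= N)%nat ->
  Cmod (1 + u 0%nat)%C <= Cmod (prodC u N).
Proof.
  intros H HN; destruct N as [|N]; [lia|]; clear HN.
  induction N as [|N IH].
  - cbn [prodC]; rewrite Cmult_1_l; lra.
  - change (prodC u (S (S N))) with (prodC u (S N) * (1 + u (S N)))%C.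
    rewrite Cmod_mult; specialize (H (S N)).
    pose proof (Cmod_ge_0 (1 + u 0%nat)%C); nra.
Qed.

Lemma Cmod_waveprod_real_ge (e : nat -> R) (x : R) :
  is_sign e -> coef 0 * exp (2 * PI * x) <= Cmod (waveprod e (RtoC x)).
Proof.
  intros He.
  apply (tends_Cmod_ge _ _ _ 1 (tends_waveprod e (RtoC x) He)).
  intros N HN; eapply Rle_trans; [|apply Cmod_prodC_ge; [|exact HN]].
  - cbv beta; rewrite term_line by apply real_in_parallel_lines.
    eapply Rle_trans; [|apply Cmod_one_plus_imag_ge].
    cbn [fst RtoC]; rewrite Rabs_mult, He, Rmult_1_l, pow_1; apply Rle_abs.
  - intros k; cbv beta; rewrite term_line by apply real_in_parallel_lines.
    apply Cmod_one_plus_imag_ge.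
Qed.

(** If a < 1 then exp (x^a) <= exp x for x >= 1, which is too small because
    2 pi > 2: c exp x <= K fails at x = max (M, 1, K / c). *)
Lemma growth_bound_ge_1 (f : C -> C) (c a : R) :
  0 < c -> (forall x, c * exp (2 * PI * x) <= Cmod (f (RtoC x))) ->
  growth_bound f a -> 1 <= a.
Proof.
  intros Hc H (K & M & HM & HK).
  apply Rnot_lt_le; intros Ha.
  set (x := Rmax (Rmax M 1) (K / c)).
  assert (M <= x) as HxM by (unfold x; rewrite <- Rmax_l; apply Rmax_l).
  assert (1 <= x) as Hx1 by (unfold x; rewrite <- Rmax_l; apply Rmax_r).
  assert (K / c <= x) as HxK by apply Rmax_r.
  specialize (HK (RtoC x)); rewrite Cmod_R, Rabs_pos_eq in HK by lra.
  specialize (HK HxM); specialize (H x).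
  assert (Rpower x a <= x) as Hp.
  { rewrite <- (Rpower_1 x) at 2 by lra; apply Rle_Rpower; lra. }
  apply exp_le_compat in Hp.
  pose proof (exp_pos (Rpower x a)) as Hpos.
  pose proof (exp_pos (2 * PI * x)) as Hpos2.
  assert (0 < K) as HK0 by nra.
  pose proof PI2_1 as HPI.
  assert (exp (x + x) <= exp (2 * PI * x)) as HE by (apply exp_le_compat; nra).
  rewrite exp_plus in HE.
  pose proof (exp_ineq1_le x) as HX; pose proof (exp_pos x) as HXp.
  assert (c * exp x * exp x <= K * exp x) as H1 by nra.
  apply Rmult_le_reg_r in H1; [|exact HXp].
  assert (K <= c * x).
  { apply Rmult_le_compat_l with (r := c) in HxK; [|lra].
    replace (c * (K / c)) with K in HxK by (field; lra); exact HxK. }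
  nra.
Qed.

Lemma waveprod_order (e : nat -> R) : is_sign e -> entire_of_order (waveprod e) 1.
Proof.
  intros He; repeat split.
  - now apply waveprod_entire.
  - exists 2; split; [lra | apply waveprod_growth; [exact He | lra]].
  - apply is_glb_Rbar_unique; split.
    + intros a [_ Ha]; cbn.
      apply (growth_bound_ge_1 (waveprod e) (coef 0)); auto using coef_pos.
      intros x; now apply Cmod_waveprod_real_ge.
    + intros b Hb.
      assert (forall a, 1 < a -> Rbar_le b a) as Hb'.
      { intros a Ha; apply Hb; split; [lra | now apply waveprod_growth]. }
      destruct b as [b | | ]; cbn in *; auto.
      * apply Rnot_lt_le; intros Hlt.
        specialize (Hb' ((1 + b) / 2)); lra.
      * apply (Hb' 2); lra.
Qed.

(** * Changing one sign *)

(** No index k satisfies k + 1 = 0, so [flip 0] is the constant sequence 1. *)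
Definition flip (n k : nat) : R := if Nat.eqb (S k) n then -1 else 1.

Lemma flip_is_sign (n : nat) : is_sign (flip n).
Proof.
  intros k; unfold flip; destruct (Nat.eqb (S k) n).
  - rewrite Rabs_left; lra.
  - apply Rabs_R1.
Qed.

Lemma term_flip_neq (n k : nat) (z : C) :
  S k <> n -> term (flip n) k z = term (flip 0) k z.
Proof.
  intros H; unfold term, flip.
  now rewrite (proj2 (Nat.eqb_neq (S k) n) H).
Qed.

Lemma term_flip_eq (k : nat) (z : C) :
  term (flip (S k)) k z = (- term (flip 0) k z)%C.
Proof.
  unfold term, flip; rewrite Nat.eqb_refl; cbn [Nat.eqb].
  change (-1) with (- (1)); rewrite !RtoC_mult, RtoC_opp; ring.
Qed.

Lemma Cmod_waveprod_flip (n : nat) (z : C) :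
  parallel_lines n z -> Cmod (waveprod (flip 0) z) = Cmod (waveprod (flip n) z).
Proof.
  intros Hz.
  apply (tends_Cmod_eq _ _ _ _ (tends_waveprod _ z (flip_is_sign 0))
    (tends_waveprod _ z (flip_is_sign n))).
  intros N; induction N as [|N IH]; [reflexivity|].
  cbn [prodC]; rewrite !Cmod_mult, IH; f_equal.
  destruct (Nat.eq_dec (S N) n) as [<- | Hn]; [|now rewrite (term_flip_neq n N)].
  rewrite !term_line, !Cmod_one_plus_imag by exact Hz.
  unfold flip; rewrite Nat.eqb_refl; cbn [Nat.eqb]; do 2 f_equal; ring.
Qed.

Lemma prodC_change_one (u v : nat -> C) (k : nat) :
  (forall j, j <> k -> u j = v j) ->
  forall N, (S k <= N)%nat ->
  (prodC u N * (1 + v k))%C = (prodC v N * (1 + u k))%C.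
Proof.
  intros H.
  assert (forall N, (N <= k)%nat -> prodC u N = prodC v N) as E.
  { intros N; induction N as [|N IH]; intros HN; [reflexivity|].
    cbn [prodC]; rewrite IH, H by lia; reflexivity. }
  intros N HN; induction HN as [|N HN IH]; cbn [prodC].
  - rewrite E by lia; ring.
  - rewrite (H N) by lia.
    replace (prodC u N * (1 + v N) * (1 + v k))%C
      with (prodC u N * (1 + v k) * (1 + v N))%C by ring.
    rewrite IH; ring.
Qed.

(** Cross-multiplied form of f_0 / f_n = (1 + t) / (1 - t), which avoids dividing by
    functions that have zeros. *)
Lemma waveprod_flip_cross (k : nat) (z : C) :
  (waveprod (flip 0) z * (1 - term (flip 0) k z))%C =
  (waveprod (flip (S k)) z * (1 + term (flip 0) k z))%C.
Proof.
  rewrite !(Cmult_comm (waveprod _ _)).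
  apply (tends_unique _ _ _ _ (S k)
    (tends_scal _ _ _ (tends_waveprod _ z (flip_is_sign 0)))
    (tends_scal _ _ _ (tends_waveprod _ z (flip_is_sign (S k))))).
  intros N HN.
  assert (forall j, j <> k -> term (flip 0) j z = term (flip (S k)) j z) as H
    by (intros j Hj; symmetry; apply term_flip_neq; lia).
  pose proof (prodC_change_one (fun j => term (flip 0) j z)
    (fun j => term (flip (S k)) j z) k H N HN) as E.
  cbv beta in E; rewrite term_flip_eq in E.
  etransitivity; [|etransitivity; [exact E|]]; ring.
Qed.

(** On the real line f_n has no zeros, so proportionality with constant e^(i alpha)
    means e^(i alpha) (1 - i t) = 1 + i t for all t = c exp (2 pi n x).  The real part,
    cos alpha + t sin alpha = 1, at two values of t gives sin alpha = 0 and
    cos alpha = 1, and then the imaginary part gives t = 0. *)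
Lemma waveprod_flip_not_equiv (k : nat) :
  ~ equiv_phase (waveprod (flip 0)) (waveprod (flip (S k))).
Proof.
  intros [alpha H].
  set (t := fun x => coef k * exp (2 * PI * x) ^ S k).
  assert (forall x, cos alpha + sin alpha * t x = 1 /\ sin alpha - cos alpha * t x = t x)
    as L.
  { intros x; specialize (H (RtoC x)).
    pose proof (waveprod_flip_cross k (RtoC x)) as E.
    rewrite H, term_line in E by apply real_in_parallel_lines.
    change (flip 0 k) with 1 in E; cbn [fst RtoC] in E.
    rewrite Rmult_1_l in E; fold (t x) in E.
    assert (waveprod (flip (S k)) (RtoC x) <> 0%C) as N0.
    { apply Cmod_gt_0; eapply Rlt_le_trans;
        [|apply Cmod_waveprod_real_ge, flip_is_sign].
      apply Rmult_lt_0_compat; apply exp_pos. }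
    assert ((cis alpha * (1 - RtoC (t x) * Ci))%C = (1 + RtoC (t x) * Ci)%C) as E2.
    { set (w := waveprod (flip (S k)) (RtoC x)) in *.
      transitivity (/ w * (cis alpha * w * (1 - RtoC (t x) * Ci)))%C;
        [field; exact N0 | rewrite E; field; exact N0]. }
    unfold cis, RtoC, Ci, Cmult, Cminus, Cplus, Copp in E2; cbn [fst snd] in E2.
    injection E2; intros; lra. }
  assert (0 < t 0) as T0
    by (apply Rmult_lt_0_compat; [apply coef_pos | apply pow_lt, exp_pos]).
  assert (t 0 < t 1) as T1.
  { apply Rmult_lt_compat_l; [apply coef_pos|].
    rewrite <- !exp_INR_mult; apply exp_increasing.
    apply Rmult_lt_compat_l; [apply lt_0_INR; lia|].
    pose proof PI_RGT_0; lra. }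
  destruct (L 0) as [A0 B0], (L 1) as [A1 B1].
  assert (sin alpha * (t 1 - t 0) = 0) as S0 by lra.
  apply Rmult_integral in S0; destruct S0 as [S0 | S0]; [|lra].
  rewrite S0 in *; nra.
Qed.

Theorem theorem2 :
  exists f : nat -> C -> C,
    (forall n : nat, entire_of_order (f n) 1) /\
    (forall n : nat, (1 <= n)%nat ->
       ~ equiv_phase (f 0%nat) (f n) /\
       (forall z : C, parallel_lines n z -> Cmod (f 0%nat z) = Cmod (f n z))).
Proof.
  exists (fun n => waveprod (flip n)); split.
  - intros n; apply waveprod_order, flip_is_sign.
  - intros n Hn; split.
    + destruct n as [|k]; [lia | apply waveprod_flip_not_equiv].
    + intros z; apply Cmod_waveprod_flip.
Qed.
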